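(* Let $X$ be a real random variable that is bounded above, with distribution function $F_X$ and $\mathcal M=\sup\{x:\mathbb P(X\le x)<1\}$. Suppose $X$ lies in the Weibull regime with parameter $\alpha>0$, i.e. $x\mapsto 1-F_X(\mathcal M-x)$ is regularly varying at $0$ of index $\alpha$. For $\theta>0$ let $$M_\theta=\frac{\mathbb E[e^{2\theta X}]}{\mathbb E[e^{\theta X}]^2}.$$ Then for every sequence $\theta_n\to\infty$, $$\Bigl(1-F_X\bigl(\mathcal M-\tfrac1{\theta_n}\bigr)\Bigr)M_{\theta_n}\to\frac{2^{-\alpha}}{\Gamma(1+\alpha)}.$$
   Context: A function $f$ is regularly varying at $0$ with index $\alpha$ if $\lim_{t\downarrow0}f(tu)/f(t)=u^\alpha$ for all $u>0$. $\Gamma$ is the Gamma function. *)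

(* Defs.v *)
From HB Require Import structures.
From mathcomp Require Import all_boot all_order all_algebra.
From mathcomp Require Import all_classical all_reals all_analysis.
Set Implicit Arguments.
Unset Strict Implicit.
Unset Printing Implicit Defensive.
Import Order.TTheory GRing.Theory Num.Theory.
Import numFieldNormedType.Exports.
Local Open Scope classical_set_scope.
Local Open Scope ring_scope.

(* Since [x / 0 = 0] here, the case [u = 1] forces [f t != 0] for all small
   [t > 0], so the quotients are genuine near 0. *)
Definition regularly_varying_at0 (R : realType) (f : R -> R) (alpha : R) : Prop :=
  forall u : R, 0 < u -> (f (t * u) / f t @[t --> 0^'+]) --> u `^ alpha.

(* Euler's integral; meaningful for [0 < s] only. *)
Definition Gamma (R : realType) (s : R) : R :=
  \int[lebesgue_measure]_(t in `]0, +oo[) (t `^ (s - 1) * expR (- t)).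

Section random_variable_bounded_above.
Context (d : measure_display) (T : measurableType d) (R : realType).
Variables (P : probability T R) (X : {RV P >-> R}).

Definition as_bounded_above : Prop :=
  exists b : R, {ae P, forall w : T, X w <= b}.

Definition distr_fun (x : R) : R := fine (cdf X x).

(* The set is never empty, and it is bounded above when [X] is, so that this
   real-valued [sup] is then the actual supremum. *)
Definition right_endpoint : R := sup [set x : R | distr_fun x < 1].

Definition weibull_regime (alpha : R) : Prop :=
  regularly_varying_at0 (fun x => 1 - distr_fun (right_endpoint - x)) alpha.

(* When [X] is bounded above and [0 < theta], both expectations are finite and
   positive, so [fine] loses nothing. *)
Definition exp_moment_ratio (theta : R) : R :=
  fine ('E_P[fun w : T => expR (2 * theta * X w)]) /
  fine ('E_P[fun w : T => expR (theta * X w)]) ^+ 2.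

End random_variable_bounded_above.

(* Main.v *)
Require Import Defs.
From HB Require Import structures.
From mathcomp Require Import all_boot all_order all_algebra.
From mathcomp Require Import all_classical all_reals all_analysis.
From mathcomp Require Import measurable_realfun ring lra.
Import Order.TTheory GRing.Theory Num.Theory.
Import numFieldNormedType.Exports.
Local Open Scope classical_set_scope.
Local Open Scope ring_scope.

(** With [f t = P(X > M - t)], writing [exp (theta X)] as a tail integral of
    [exp (- v)] and exchanging integrals gives
    [E exp (theta X) = exp (theta M) * \int_0^oo f (v / theta) exp (- v) dv].
    Iterating [f (2 t) <= 2^p f t] yields the Potter-type bound
    [f (v t) <= C exp (v / 2) f t], so that dominated convergence turns regular
    variation into [\int_0^oo f (v t) exp (- v) dv / f t --> Gamma (1 + alpha)]
    as [t] tends to 0. The theorem follows by applying this at [t = 1 / theta]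
    and [t = 1 / (2 theta)], since [f (t / 2) / f t --> 2^(- alpha)]. *)

(** * Exponential tails and the Gamma integral *)

Lemma integral_expR_tail (R : realType) (c a : R) : 0 < c ->
  (\int[lebesgue_measure]_(x in `]a, +oo[) (expR (- c * x))%:E
    = (c^-1 * expR (- c * a))%:E)%E.
Proof.
move=> c0.
have cM : continuous (fun z : R => expR (- c * z)).
  move=> z; apply: continuous_comp; last exact: continuous_expR.
  exact: mulrl_continuous.
rewrite integral_itv_obnd_cbnd; last first.
  by apply/measurable_EFinP; apply: measurable_funTS; exact: continuous_measurable_fun.
rewrite (@ge0_continuous_FTC2y _ _ (fun x => - (c^-1 * expR (- c * x))) _ 0).
- by rewrite -EFinB sub0r opprK.
- by move=> x _; exact: expR_ge0.
- exact: continuous_subspaceT.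
- rewrite -oppr0; apply: cvgN; rewrite -[X in _ --> X](mulr0 c^-1).
  apply: cvgMr.
  rewrite (_ : (fun x => expR (- c * x)) =
               (fun z => expR (- z)) \o (fun z => c * z)); last first.
    by apply: eq_fun => x; rewrite mulNr.
  apply: (@cvg_comp _ _ _ _ _ _ (pinfty_nbhs R)); last exact: cvgr_expR.
  exact: gt0_cvgMry.
- by move=> x _; exact: ex_derive.
- by apply: cvgN; apply: cvgMr; apply: cvg_at_right_filter; exact: cM.
- move=> x _; rewrite derive1E derive_val /GRing.scale/=.
  by field; rewrite gt_eqF.
Qed.

(** Supplies the dominating functions; both later uses take [c] equal to 1/2. *)
Lemma integrable_expR_tail (R : realType) (C c a : R) : 0 < c ->
  lebesgue_measure.-integrable `]a, +oo[ (fun x => (C * expR (- c * x))%:E).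
Proof.
move=> c0.
have mexp : measurable_fun `]a, +oo[ (fun x => (expR (- c * x))%:E).
  apply/measurable_EFinP/measurable_funTS.
  apply: (@measurableT_comp _ _ _ _ _ _ expR _ (fun x => - c * x)) => //.
  exact: mulrl_measurable.
apply/integrableP; split.
  by apply/measurable_EFinP; apply: measurable_funM => //; exact/measurable_EFinP.
rewrite [ltLHS](_ : _ = (\int[lebesgue_measure]_(x in `]a, +oo[)
    (`|C|%:E * (expR (- c * x))%:E))%E); last first.
  by apply: eq_integral => x _; rewrite abse_EFin normrM (ger0_norm (expR_ge0 _)) EFinM.
rewrite ge0_integralZl_EFin//=.
by rewrite integral_expR_tail// -!EFinM ltry.
Qed.

(** A single term of the exponential series is at most its sum. *)
Lemma exprn_le_expR (R : realType) (x : R) (n : nat) : 0 <= x ->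
  x ^+ n <= n`!%:R * expR x.
Proof.
case: n => [|n] x0; first by rewrite expr0 fact0 mul1r -expR0 ler_expR.
rewrite -ler_pdivrMl ?ltr0n ?fact_gt0//.
by apply: le_trans (expR_ge1Dxn n x0); rewrite mulrC lerDr.
Qed.

(** The rate 1/2 is chosen so that multiplying by exp (- x) still leaves the integrable factor exp
    (- x / 2). *)
Lemma max1_exprn_le_expR (R : realType) (x : R) (n : nat) : 0 <= x ->
  Num.max 1 x ^+ n <= 2 ^+ n * n`!%:R * expR (x / 2).
Proof.
move=> x0; have [x1|x1] := leP x 1.
  rewrite expr1n -[leLHS]mulr1 ler_pM//; last by rewrite -[leLHS]expR0 ler_expR; lra.
  by rewrite -[leLHS]mulr1 ler_pM// ?exprn_ege1 ?ler1n// fact_gt0.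
have -> : x ^+ n = 2 ^+ n * (x / 2) ^+ n.
  by rewrite -exprMn; congr (_ ^+ _); field.
rewrite -mulrA ler_wpM2l ?exprn_ge0//.
by apply: exprn_le_expR; rewrite divr_ge0.
Qed.

(** For an integer n > s - 1, the power is at most max(1, t)^n, hence at most C exp (t / 2). The
    condition [1 <= s] keeps the integrand bounded near 0 and covers [s = 1 + alpha]. *)
Lemma integrable_Gamma (R : realType) (s : R) : 1 <= s ->
  lebesgue_measure.-integrable `]0, +oo[
    (fun t => (t `^ (s - 1) * expR (- t))%:E).
Proof.
move=> s1; set n := (Num.truncn (s - 1)).+1; pose C : R := 2 ^+ n * n`!%:R.
have powC t : 0 < t -> t `^ (s - 1) <= C * expR (t / 2).
  move=> t0; apply: le_trans (@max1_exprn_le_expR _ _ _ (ltW t0)).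
  rewrite -powR_mulrn ?le_max ?ler01//.
  apply: (@le_trans _ _ (Num.max 1 t `^ (s - 1))).
    apply: ge0_ler_powR; rewrite ?nnegrE ?subr_ge0 ?le_max ?ler01 ?lexx ?orbT//.
    exact: ltW.
  by apply: ler_powR; rewrite ?le_max ?lexx// ltW// truncnS_gt.
have half_gt0 : 0 < (2^-1 : R) by rewrite invr_gt0.
apply: (le_integrable _ _ _ (@integrable_expR_tail _ C _ 0 half_gt0)) => //.
- apply/measurable_EFinP; apply: measurable_funM; apply: measurable_funTS.
    exact: measurable_powR.
  by apply: measurableT_comp.
- move=> t /=; rewrite in_itv/= andbT => t0.
  rewrite lee_fin ger0_norm ?mulr_ge0 ?powR_ge0 ?expR_ge0//.
  apply: le_trans (ler_norm _); rewrite (_ : - 2^-1 * t = t / 2 - t); last by field.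
  by rewrite expRD mulrA ler_wpM2r ?expR_ge0// powC.
Qed.

(** On ]1, +oo[ the integrand is at least exp (- t), whose integral there is exp (- 1). *)
Lemma Gamma_gt0 (R : realType) (s : R) : 1 <= s -> 0 < Gamma s.
Proof.
move=> s1; have iG := @integrable_Gamma _ _ s1.
apply: (@lt_le_trans _ _ (expR (- 1 * 1))); first exact: expR_gt0.
rewrite /Gamma /Rintegral -[leLHS]/(fine (expR (- 1 * 1))%:E).
apply: fine_le => //; first exact: integrable_fin_num.
have /measurable_EFinP mG := measurable_int _ iG.
rewrite -[leLHS]mul1e -[X in (X%:E * _)%E]invr1 -EFinM -integral_expR_tail//.
apply: (@le_trans _ _ (\int[lebesgue_measure]_(t in `]1%R, +oo[)
   (t `^ (s - 1) * expR (- t))%:E)%E).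
  apply: ge0_le_integral => //.
  - apply/measurable_EFinP; apply: measurable_funTS.
    by apply: measurableT_comp => //; exact: mulrl_measurable.
  - apply/measurable_EFinP; apply: measurable_funS mG => //.
    by apply: subset_itvr; rewrite bnd_simp.
  - move=> t /=; rewrite in_itv/= andbT => t1.
    rewrite lee_fin mulN1r ler_peMl ?expR_ge0//.
    by rewrite -[leLHS](powRr0 t) ler_powR ?subr_ge0// ltW.
apply: ge0_subset_integral => //.
- exact/measurable_EFinP.
- by move=> t _; rewrite lee_fin mulr_ge0 ?powR_ge0 ?expR_ge0.
- by apply: subset_itvr; rewrite bnd_simp.
Qed.

(** Lets a positive constant leave an integral before finiteness is known: [fine] sends both
    infinities to 0. *)
Lemma gt0_fineZl (R : realFieldType) (c : R) (x : \bar R) : 0 < c ->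
  fine (c%:E * x)%E = c * fine x.
Proof.
case: x => [x| |] c0; first by [].
- by rewrite mulry gtr0_sg// mul1e mulr0.
- by rewrite mulrNy gtr0_sg// mul1e mulr0.
Qed.

(** * Potter-type bound and Laplace integrals under regular variation *)

Lemma regularly_varying_at0_doubling (R : realType) (f : R -> R) (alpha : R) :
  (forall t, 0 < t -> 0 < f t) -> regularly_varying_at0 f alpha ->
  exists p : nat, exists2 t0, 0 < t0 &
    forall t, 0 < t -> t <= t0 -> f (t * 2) <= 2 ^+ p * f t.
Proof.
move=> f_gt0 /(_ 2 (ltr0n _ 2)) f2.
(* The ratio at [u = 2] tends to 2^alpha, so any strictly larger bound holds near 0; an integer
   exponent makes it easy to iterate. *)
have [p hp] : exists p : nat, 2 `^ alpha < 2 ^+ p :> R.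
  exists (Num.truncn alpha).+2; apply: (@le_lt_trans _ _ (2 ^+ (Num.truncn alpha).+1)).
    by rewrite -powR_mulrn// ler_powR ?ler1n// ltW// truncnS_gt.
  by rewrite ltr_eXn2l// ltr1n.
have [e /= e0 he] : \forall t \near (0 : R)^'+, f (t * 2) / f t < 2 ^+ p.
  exact: cvgr_lt f2 _ hp.
exists p; exists (e / 2); first exact: divr_gt0.
move=> t t_gt0 te; apply/ltW; rewrite -ltr_pdivrMr ?f_gt0//; apply: he => //=.
by rewrite sub0r normrN gtr0_norm//; lra.
Qed.

(* Truncating [f] to [min (f t) (f t0)] makes the doubling bound global. *)
Lemma regularly_varying_at0_le_expR (R : realType) (f : R -> R) (alpha : R) :
  {homo f : x y / x <= y} -> (forall t, f t <= 1) ->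
  (forall t, 0 < t -> 0 < f t) -> regularly_varying_at0 f alpha ->
  exists2 C : R, 0 <= C &
    forall v t, 0 < v -> 0 < t -> f (v * t) <= C * expR (v / 2) * f t.
Proof.
move=> f_nd f_le1 f_gt0 fRV.
have [p [t0 t0_gt0 f2]] := @regularly_varying_at0_doubling _ _ _ f_gt0 fRV.
pose g t := Num.min (f t) (f t0).
have g_ge0 t : 0 < t -> 0 <= g t by move=> t0'; rewrite le_min !ltW// f_gt0.
have g2 t : 0 < t -> g (t * 2) <= 2 ^+ p * g t.
  move=> t_gt0; have [tt0|t0t] := leP t t0.
    have -> : g t = f t by apply/min_idPl; exact: f_nd.
    by rewrite ge_min f2.
  have -> : g t = f t0 by apply/min_idPr/f_nd/ltW.
  rewrite ge_min; apply/orP; right; apply: ler_peMl; first by rewrite ltW// f_gt0.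
  by rewrite exprn_ege1// ler1n.
have g2n k t : 0 < t -> g (2 ^+ k * t) <= (2 ^+ k) ^+ p * g t.
  move=> t_gt0; elim: k => [|k IH]; first by rewrite !expr0 expr1n !mul1r.
  rewrite exprS -mulrA mulrC (le_trans (g2 _ _))//.
    by rewrite mulr_gt0// exprn_gt0.
  by rewrite exprMn -mulrA ler_wpM2l// exprn_ge0.
(* Since [f] is at most 1, undoing the truncation costs only the constant factor 1 / f t0. *)
have fg t : 0 < t -> f t <= (f t0)^-1 * g t.
  move=> t_gt0; rewrite ler_pdivlMl ?f_gt0// le_min; apply/andP; split.
    by apply: ler_piMl => //; rewrite ltW// f_gt0.
  by apply: ler_piMr => //; rewrite ltW// f_gt0.
pose C := (f t0)^-1 * (4 ^+ p * p`!%:R).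
have C_ge0 : 0 <= C.
  by rewrite !mulr_ge0// ?invr_ge0 ?ltW ?f_gt0// exprn_ge0.
have powC v k : 0 < v -> 2 ^+ k <= 2 * Num.max 1 v ->
    (2 ^+ k) ^+ p <= 4 ^+ p * p`!%:R * expR (v / 2) :> R.
  move=> v_gt0 kv; apply: (@le_trans _ _ ((2 * Num.max 1 v) ^+ p)).
    by rewrite lerXn2r// nnegrE ?exprn_ge0// mulr_ge0// le_max ler01.
  have -> : 4 ^+ p * p`!%:R * expR (v / 2) =
      2 ^+ p * (2 ^+ p * p`!%:R * expR (v / 2)) :> R.
    by rewrite !mulrA -exprMn -natrM.
  by rewrite exprMn ler_wpM2l ?exprn_ge0// max1_exprn_le_expR// ltW.
exists C => // v t v_gt0 t_gt0.
(* Rounds [v] up to a power of 2, overshooting max(1, v) by a factor of at most 2; that factor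
   contributes 2^p to the 4^p in [C]. *)
have [k vk kv] : exists2 k, v <= 2 ^+ k & 2 ^+ k <= 2 * Num.max 1 v.
  have [v1|v1] := leP v 1; first by exists 0%N; rewrite expr0//; lra.
  exists (trunc_log 2 (Num.truncn v)).+1.
    apply: (le_trans (ltW (truncnS_gt v))); rewrite -natrX ler_nat.
    exact: trunc_log_ltn.
  rewrite exprS ler_pM2l//.
  rewrite -natrX -truncn_ge_nat; last exact: ltW.
  by apply: trunc_logP => //; rewrite truncn_gt0 ltW.
(* The chain is f (v t) <= f (2^k t) <= g (2^k t) / f t0 <= (2^k)^p g t / f t0, followed by g t <= f
   t. *)
apply: (le_trans (f_nd _ (2 ^+ k * t) _)); first by rewrite ler_pM2r.
apply: (le_trans (fg _ _)); first by rewrite mulr_gt0// exprn_gt0.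
rewrite /C -!mulrA.
apply: ler_wpM2l; first by rewrite invr_ge0 ltW// f_gt0.
apply: (le_trans (g2n _ _ t_gt0)); rewrite !mulrA ler_pM ?exprn_ge0 ?g_ge0//.
  exact: powC.
by rewrite ge_min lexx.
Qed.

(** Stated along a sequence so that the dominated convergence theorem applies directly. *)
Lemma regularly_varying_at0_laplace (R : realType) (f : R -> R) (alpha : R)
    (t : nat -> R) :
  {homo f : x y / x <= y} -> (forall t, f t <= 1) ->
  (forall t, 0 < t -> 0 < f t) -> regularly_varying_at0 f alpha ->
  (forall n, 0 < t n) -> (t n @[n --> \oo] --> 0) ->
  ((\int[lebesgue_measure]_(v in `]0, +oo[) (f (v * t n) * expR (- v)))
     / f (t n) @[n --> \oo]) --> Gamma (1 + alpha).
Proof.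
move=> f_nd f_le1 f_gt0 fRV t_gt0 t0.
have [C C_ge0 fC] := @regularly_varying_at0_le_expR _ _ _ f_nd f_le1 f_gt0 fRV.
pose D := [set` `]0, +oo[%R : interval R]; have mD : measurable D by exact: measurable_itv.
pose h n v : \bar R := (f (v * t n) / f (t n) * expR (- v))%:E.
pose h_ v : \bar R := (v `^ (1 + alpha - 1) * expR (- v))%:E.
pose g v : \bar R := (C * expR (- 2^-1 * v))%:E.
have mexp : measurable_fun D (fun v : R => expR (- v)).
  by apply: measurable_funTS; apply: measurableT_comp.
have mf n : measurable_fun D (fun v => f (v * t n)).
  apply: nondecreasing_measurable => // x y xy.
  by apply: f_nd; rewrite ler_pM2r.
have mh n : measurable_fun D (h n).
  by apply/measurable_EFinP; apply: measurable_funM => //; apply: measurable_funM.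
have mh_ : measurable_fun D h_.
  apply/measurable_EFinP; apply: measurable_funM => //.
  by apply: measurable_funTS; exact: measurable_powR.
have ig : lebesgue_measure.-integrable D g by apply: integrable_expR_tail; rewrite invr_gt0.
(* The bound C exp (v / 2) on the quotient, times exp (- v), leaves C exp (- v / 2), uniformly in
   [n]. *)
have hg n v : D v -> (`|h n v| <= g v)%E.
  rewrite /D/= in_itv/= andbT => v0; rewrite lee_fin ger0_norm; last first.
    by rewrite mulr_ge0 ?expR_ge0// divr_ge0// ltW// f_gt0// mulr_gt0.
  rewrite mulrAC ler_pdivrMr ?f_gt0//.
  apply: (@le_trans _ _ (C * expR (v / 2) * f (t n) * expR (- v))).
    by rewrite ler_wpM2r ?expR_ge0// fC.
  rewrite mulrAC -[X in X * _]mulrA -expRD.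
  by rewrite (_ : v / 2 - v = - 2^-1 * v)//; lra.
have hE n : (\int[lebesgue_measure]_(v in D) (f (v * t n) * expR (- v)))
     / f (t n) = fine (\int[lebesgue_measure]_(v in D) h n v)%E.
  rewrite /h; under [in RHS]eq_integral => v _ do
    rewrite mulrAC mulrC EFinM.
  rewrite ge0_integralZl_EFin//; last 3 first.
  - move=> v; rewrite /D/= in_itv/= andbT => v0.
    by rewrite lee_fin mulr_ge0 ?expR_ge0// ltW// f_gt0// mulr_gt0.
  - apply/measurable_EFinP; apply: measurable_funM; last exact: mexp.
    exact: mf.
  - by rewrite invr_ge0 ltW// f_gt0.
  by rewrite gt0_fineZl ?invr_gt0 ?f_gt0// mulrC.
under eq_fun do rewrite hE.
have [ih_ _ cvgh] : [/\ lebesgue_measure.-integrable D h_,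
    [sequence \int[lebesgue_measure]_(v in D) `|h n v - h_ v|]_n @ \oo --> 0 &
    [sequence \int[lebesgue_measure]_(v in D) h n v]_n @ \oo
      --> \int[lebesgue_measure]_(v in D) h_ v]%E.
  apply: (dominated_convergence _ _ _ _ ig) => //.
    apply: aeW => v; rewrite /D/= in_itv/= andbT => v0.
    apply: cvg_EFin; first by apply: nearW.
    (* The pointwise limit is regular variation at [u = v], read along the sequence [t]. *)
    apply: cvgMl; rewrite addrAC subrr add0r.
    under eq_fun do rewrite (mulrC v).
    exact: ((cvg_at_rightP _ _ _).1 (fRV v v0) t (conj t_gt0 t0)).
  by apply: aeW => v n; exact: hg.
rewrite /Gamma /Rintegral; apply: fine_cvg.
by rewrite fineK//; exact: integrable_fin_num.
Qed.

(** * The distribution function and its right endpoint *)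

Lemma distr_fun_cdf d (T : measurableType d) (R : realType)
    (P : probability T R) (X : {RV P >-> R}) (x : R) :
  (distr_fun X x)%:E = cdf X x.
Proof. by rewrite fineK// fin_num_measure. Qed.

Lemma distr_fun_nondecreasing d (T : measurableType d) (R : realType)
    (P : probability T R) (X : {RV P >-> R}) :
  {homo distr_fun X : x y / x <= y}.
Proof.
by move=> x y xy; rewrite -lee_fin !distr_fun_cdf; exact: cdf_nondecreasing.
Qed.

(** Decay of the distribution function at -oo makes the set under the supremum nonempty, so it has a
    point above [x]; monotonicity concludes. This gives the positivity of the tail that allows
    dividing by it. *)
Lemma distr_fun_lt1 d (T : measurableType d) (R : realType)
    (P : probability T R) (X : {RV P >-> R}) (x : R) :
  x < right_endpoint X -> distr_fun X x < 1.
Proof.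
have S0 : [set x : R | distr_fun X x < 1] !=set0.
  have : distr_fun X x @[x --> -oo] --> (0 : R).
    exact: (fine_cvg (cvg_cdfNy0 X)).
  move=> /(cvgr_lt _) /(_ 1 ltr01) [M [_ /(_ (M - 1))]] h.
  by exists (M - 1); apply: h; rewrite ltrBlDr ltrDl.
move=> /(sup_gt S0)[y /=] y1 xy.
by apply: le_lt_trans y1; apply: distr_fun_nondecreasing; exact: ltW.
Qed.

(** The value is 1 at every point beyond the endpoint, and right continuity carries it to the
    endpoint itself. *)
Lemma distr_fun_right_endpoint d (T : measurableType d) (R : realType)
    (P : probability T R) (X : {RV P >-> R}) :
  as_bounded_above X -> distr_fun X (right_endpoint X) = 1.
Proof.
move=> [b [N [mN N0 Nb]]].
have ub : has_ubound [set x : R | distr_fun X x < 1].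
  exists b => x /= x1; rewrite leNgt; apply/negP => bx.
  (* The event X > b is negligible, so the distribution function is already 1 at [b], contradicting
     a value below 1 at some x > b. *)
  have : (P (X @^-1` `]b, +oo[) <= P N)%E.
    have mb : measurable (X @^-1` `]b, +oo[).
      by rewrite -[X in measurable X]setTI; exact: measurable_funP.
    apply: le_measure; rewrite ?inE//.
    move=> w /=; rewrite in_itv/= andbT => bw; apply: Nb => /=.
    by rewrite leNgt bw.
  rewrite N0 -[leLHS]/(ccdf X b) ccdf_1_cdf -distr_fun_cdf -EFinB lee_fin subr_le0.
  by move=> /le_trans/(_ (@distr_fun_nondecreasing _ _ _ P X _ _ (ltW bx))); rewrite leNgt x1.
have X1 x : right_endpoint X < x -> distr_fun X x = 1.
  move=> Mx; apply/eqP; rewrite eq_le -{1}lee_fin distr_fun_cdf cdf_le1/=.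
  rewrite leNgt; apply/negP => x1.
  by move: Mx; rewrite ltNge ub_le_sup.
have : cdf X x @[x --> (right_endpoint X)^'+] --> (distr_fun X (right_endpoint X))%:E.
  by rewrite distr_fun_cdf; exact: cdf_right_continuous.
move=> /fine_cvg cM; apply: (cvg_unique _ cM) => //.
apply: cvg_near_cst; near=> x; apply: X1; near: x; exact: nbhs_right_gt.
Unshelve. all: by end_near. Qed.

Lemma ae_le_right_endpoint d (T : measurableType d) (R : realType)
    (P : probability T R) (X : {RV P >-> R}) :
  as_bounded_above X -> {ae P, forall w, X w <= right_endpoint X}.
Proof.
move=> /distr_fun_right_endpoint X1.
exists (X @^-1` `]right_endpoint X, +oo[); split.
- exact: measurable_funPTI.
- by rewrite [LHS](ccdf_1_cdf X) -distr_fun_cdf X1 subee.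
- by move=> w /=; rewrite in_itv/= andbT => /negP; rewrite -ltNge.
Qed.

(** * Exponential moments as Laplace integrals of the tail *)

Lemma expectation_expR (d : measure_display) (T : measurableType d)
    (R : realType) (P : probability T R) (X : {RV P >-> R}) (M theta : R) :
  {ae P, forall w, X w <= M} -> 0 < theta ->
  fine 'E_P[fun w => expR (theta * X w)] = expR (theta * M) *
    \int[lebesgue_measure]_(v in `]0, +oo[)
      ((1 - distr_fun X (M - v / theta)) * expR (- v)).
Proof.
move=> XM theta_gt0; pose mu : {measure set _ -> \bar R} := @lebesgue_measure R.
(* Pairs (w, v) with v > 0 and v > theta (M - X w). Integrating exp (- v) over a slice at fixed [w]
   gives exp (- theta (M - X w)); the slice at fixed [v] is the event X > M - v / theta. *)
pose A : set (T * R) := [set z | 0 < z.2 /\ M < X z.1 + z.2 / theta].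
have mA : measurable A.
  have -> : A = [set z | 0 < z.2] `&` [set z | M < X z.1 + z.2 / theta].
    by apply/seteqP; split.
  apply: measurableI; rewrite -[X in measurable X]setTI.
    apply: (@measurable_fun_ltr _ _ _ _ (cst 0) snd _ _ measurableT [set true]) => //.
  apply: (@measurable_fun_ltr _ _ _ _ (cst M) (fun z : T * R => X z.1 + z.2 / theta)
            _ _ measurableT [set true]) => //.
  apply: measurable_funD; first exact: measurableT_comp.
  exact: measurable_funM.
pose F z : \bar R := (expR (- z.2) * \1_A z)%:E.
have F_ge0 z : (0 <= F z)%E by rewrite lee_fin mulr_ge0 ?expR_ge0.
have mexpN : measurable_fun [set: R] (fun v : R => expR (- v)).
  by apply: measurableT_comp.
have mF : measurable_fun setT F.
  apply/measurable_EFinP; apply: measurable_funM; last exact: measurable_indic.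
  exact: (measurableT_comp mexpN).
(* When X w <= M, the threshold theta (M - X w) is nonnegative, so the constraint v > 0 is
   automatic. *)
have innerv w : X w <= M ->
    (\int[mu]_v F (w, v) = (expR (- (theta * M)))%:E * (expR (theta * X w))%:E)%E.
  move=> XwM.
  transitivity (\int[mu]_(v in `](theta * (M - X w))%R, +oo[) (expR (- 1 * v))%:E)%E.
    rewrite [RHS]integral_mkcond; apply: eq_integral => v _.
    have AE : ((w, v) \in A) = (v \in [set` `]theta * (M - X w), +oo[]).
      apply/idP/idP; rewrite !inE /A/= in_itv/= andbT.
        by case=> _; rewrite -ltrBlDl ltr_pdivlMr// mulrC.
      move=> h; split; last by rewrite -ltrBlDl ltr_pdivlMr// mulrC.
      by apply: le_lt_trans h; rewrite mulr_ge0 ?subr_ge0// ltW.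
    by rewrite /F patchE/= indicE AE; case: ifP => _; rewrite ?mulr1 ?mulr0 ?mulN1r.
  rewrite integral_expR_tail// invr1 mul1r -EFinM -expRD.
  by congr (expR _)%:E; ring.
have innerw v : (\int[P]_w F (w, v) = ((fun v =>
   ((1 - distr_fun X (M - v / theta)) * expR (- v))%:E) \_ `]0%R, +oo[) v)%E.
  rewrite patchE; case: ifPn; rewrite ?inE ?notin_setE/= in_itv/= andbT; last first.
    move=> v0; apply: integral0_eq => w _.
    by rewrite /F/= indicE memNset ?mulr0// => -[/= /v0].
  move=> v0; pose B := X @^-1` `](M - v / theta)%R, +oo[.
  have mB : measurable B.
    by rewrite -[X in measurable X]setTI; exact: measurable_funP.
  transitivity (\int[P]_w ((expR (- v))%:E * (\1_B w)%:E))%E.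
    apply: eq_integral => w _; rewrite /F/= EFinM; congr (_ * (_%:R)%:E)%E.
    congr (nat_of_bool _); apply/idP/idP; rewrite !inE /A /B/= in_itv/= andbT ltrBlDr//.
    by case.
  rewrite ge0_integralZl_EFin ?expR_ge0//; last first.
    by apply/measurable_EFinP; exact: measurable_indic.
  rewrite integral_indic// setIT [X in (_ * X)%E](_ : _ = ccdf X (M - v / theta)%R)//.
  rewrite ccdf_1_cdf -distr_fun_cdf.
  by rewrite -EFinB -EFinM mulrC.
have FT := fubini_tonelli (m1 := P) (m2 := mu) F mF F_ge0.
have E1 : ((expR (- (theta * M)))%:E * 'E_P[fun w => expR (theta * X w)]
    = \int[mu]_(v in `]0%R, +oo[)
      ((1 - distr_fun X (M - v / theta)) * expR (- v))%:E)%E.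
  rewrite integral_mkcond; transitivity (\int[mu]_v \int[P]_w F (w, v))%E; last first.
    by apply: eq_integral => v _; exact: innerw.
  rewrite -FT unlock -ge0_integralZl_EFin ?expR_ge0//; last first.
    by apply/measurable_EFinP; apply: measurableT_comp => //; exact: measurable_funM.
  (* The inner integral was computed only where X w <= M, which holds almost everywhere. *)
  apply: ae_eq_integral => //.
  - by apply/measurable_funeM/measurable_EFinP; apply: measurableT_comp => //;
      exact: measurable_funM.
  - exact: measurable_fun_fubini_tonelli_F.
  - by move: XM; apply: filterS => w XwM _; rewrite innerv.
by rewrite /Rintegral -E1 gt0_fineZl ?expR_gt0// mulrA -expRD subrr expR0 mul1r.
Qed.

(** * Limit of the normalised moment ratio *)

Theorem theorem4 (d : measure_display) (T : measurableType d) (R : realType)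
    (P : probability T R) (X : {RV P >-> R}) (alpha : R) :
  as_bounded_above X ->
  0 < alpha ->
  weibull_regime X alpha ->
  forall theta : nat -> R, (theta n @[n --> \oo]) --> +oo ->
  ((1 - distr_fun X (right_endpoint X - 1 / theta n))
     * exp_moment_ratio X (theta n) @[n --> \oo])
    --> 2 `^ (- alpha) / Gamma (1 + alpha).
Proof.
move=> X_bdd alpha_gt0 fRV theta theta_oo.
set M := right_endpoint X; pose f t := 1 - distr_fun X (M - t).
have f_nd : {homo f : x y / x <= y}.
  by move=> x y xy; rewrite lerD2l lerN2 distr_fun_nondecreasing// lerD2l lerN2.
have f_le1 t : f t <= 1 by rewrite gerBl -lee_fin distr_fun_cdf cdf_ge0.
have f_gt0 t : 0 < t -> 0 < f t.
  by move=> t0; rewrite subr_gt0 distr_fun_lt1// gtrBl.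
(* The sequence lemmas ask for positivity at every index; this modification provides it and agrees
   with [theta] eventually. *)
pose theta' n := Num.max 1 (theta n).
have theta'_gt0 n : 0 < theta' n by rewrite lt_max ltr01.
have theta'E : \forall n \near \oo, theta' n = theta n.
  by near=> n; apply/max_idPr; near: n; exact: (cvgryPge _).1 theta_oo 1.
have theta'_oo : theta' n @[n --> \oo] --> +oo.
  apply: cvg_trans theta_oo; apply: near_eq_cvg.
  by apply: filterS theta'E => n ->.
pose L c := \int[lebesgue_measure]_(v in `]0, +oo[) (f (v * c) * expR (- v)).
have L_cvg c : 0 < c ->
    L (c * theta' n)^-1 / f (c * theta' n)^-1 @[n --> \oo] --> Gamma (1 + alpha).
  move=> c_gt0.
  apply: (@regularly_varying_at0_laplace _ _ _ (fun n => (c * theta' n)^-1)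
            f_nd f_le1 f_gt0 fRV) => [n|]; first by rewrite invr_gt0 mulr_gt0.
  apply/gtr0_cvgV0; first by apply: nearW => n; rewrite mulr_gt0.
  apply: (@cvg_comp _ _ _ theta' ( *%R c) _ _ _ theta'_oo).
  exact: gt0_cvgMry.
have EL c n : 0 < c -> fine 'E_P[fun w => expR (c * theta' n * X w)] =
    expR (c * theta' n * M) * L (c * theta' n)^-1.
  move=> c_gt0; apply: expectation_expR; last exact: mulr_gt0.
  exact: ae_le_right_endpoint.
have Gamma_gt0 : 0 < Gamma (1 + alpha).
  by apply: Gamma_gt0; rewrite lerDl ltW.
(* Regular variation at [u = 1/2] along the reciprocals of [theta']. *)
have f_half : f (2 * theta' n)^-1 / f (theta' n)^-1 @[n --> \oo] --> 2 `^ (- alpha).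
  have h2 : 0 < (2^-1 : R) by rewrite invr_gt0.
  have t_gt0 n : 0 < (theta' n)^-1 by rewrite invr_gt0.
  have t0 : (theta' n)^-1 @[n --> \oo] --> 0.
    by apply/gtr0_cvgV0 => //; apply: nearW.
  have := (cvg_at_rightP _ _ _).1 (fRV _ h2) (fun n => (theta' n)^-1)
    (conj t_gt0 t0).
  rewrite -powR_inv1// -powRrM mulN1r powR_inv1//.
  rewrite (_ : (fun n => _) = (fun n => f (2 * theta' n)^-1 / f (theta' n)^-1))//.
  by apply/funext => n; rewrite invfM (mulrC 2^-1).
(* With t = 1 / theta', this regroups f t * L (t / 2) / (L t)^2 into quotients with known limits;
   one Gamma factor cancels against the square. *)
have main : (L (2 * theta' n)^-1 / f (2 * theta' n)^-1
    * (f (2 * theta' n)^-1 / f (theta' n)^-1)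
    / (L (theta' n)^-1 / f (theta' n)^-1) ^+ 2) @[n --> \oo]
    --> 2 `^ (- alpha) / Gamma (1 + alpha).
  rewrite (_ : 2 `^ (- alpha) / Gamma (1 + alpha) =
    Gamma (1 + alpha) * 2 `^ (- alpha) / Gamma (1 + alpha) ^+ 2); last first.
    by field; rewrite gt_eqF.
  apply: cvgM; first by apply: cvgM => //; exact: L_cvg.
  apply: cvgV; first by rewrite expf_neq0// gt_eqF.
  have := L_cvg 1 ltr01; under eq_fun do rewrite mul1r.
  by move=> ?; apply: cvgM.
apply: cvg_trans main; apply: near_eq_cvg; near=> n.
have <- : theta' n = theta n by near: n.
rewrite /exp_moment_ratio EL//; have := EL 1 n ltr01; rewrite mul1r => ->.
rewrite -/M -/(f _) div1r.
(* The exponential prefactors of the numerator and the squared denominator thus cancel. *)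
have -> : expR (2 * theta' n * M) = expR (theta' n * M) ^+ 2.
  by rewrite expr2 -expRD; congr expR; ring.
have e_neq0 : expR (theta' n * M) != 0 by rewrite gt_eqF ?expR_gt0.
have f1_neq0 : f (theta' n)^-1 != 0 by rewrite gt_eqF ?f_gt0 ?invr_gt0.
have f2_neq0 : f (2 * theta' n)^-1 != 0.
  by rewrite gt_eqF ?f_gt0 ?invr_gt0 ?mulr_gt0.
(* If this integral vanished, both sides would be 0 by the convention that the inverse of 0 is 0, so
   its positivity need not be proved. *)
have [->|L_neq0] := eqVneq (L (theta' n)^-1) 0.
  by rewrite !(mulr0, mul0r, expr0n, invr0).
by field; rewrite e_neq0 L_neq0 f1_neq0 f2_neq0.
Unshelve. all: by end_near. Qed.
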